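(* Let $m:=17$, $a:=0.2$, $b:=0.045$, and let $K$ be the $18\times18$ matrix indexed by $\{0,1,\dots,m\}$ with entries $$K_{00}=1,\qquad K_{0i}=K_{i0}=a\ (i\ge1),\qquad K_{ii}=1\ (i\ge 1),\qquad K_{ij}=b\ (i\ne j,\ i,j\ge1).$$ Then $K$ is symmetric positive definite, $K$ satisfies the multiplicative triangle inequality $K_{ik}\ge K_{ij}K_{jk}$ for all $i,j,k\in\{0,\dots,m\}$, and the function $p\mapsto H_K(p)$ is not concave on the interior $\Delta_{18}^\circ$ of the probability simplex.
   Context: For a symmetric matrix $K\in[0,1]^{n\times n}$ with unit diagonal and a probability vector $p$, the discrete $K$-entropy is $H_K(p):=-\sum_i p_i\log\bigl((Kp)_i\bigr)$, where $(Kp)_i=\sum_j K_{ij}p_j$. $\Delta_{18}^\circ$ denotes the set of probability vectors on the 18 indices with all entries strictly positive. *)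

(* Defs.v *)
From HB Require Import structures.
From mathcomp Require Import all_boot all_order all_algebra.
From mathcomp Require Import all_classical all_reals all_analysis.

Set Implicit Arguments.
Unset Strict Implicit.
Unset Printing Implicit Defensive.

Import Order.TTheory GRing.Theory Num.Theory.
Local Open Scope classical_set_scope.
Local Open Scope ring_scope.
Local Open Scope convex_scope.

(* Probability vectors are column vectors, so that Kp is the product K *m p. *)

Definition K_entropy (R : realType) (n : nat) (K : 'M[R]_n) (p : 'cV[R]_n) : R :=
  - \sum_(i < n) p i 0 * ln ((K *m p) i 0).

Definition open_simplex (R : realType) (n : nat) : set 'cV[R]_n :=
  [set p | (forall i, 0 < p i 0) /\ \sum_(i < n) p i 0 = 1].
Arguments open_simplex : clear implicits.

Definition posdefmx (R : realType) (n : nat) (K : 'M[R]_n) : Prop :=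
  K \is symmetricmx /\
  forall x : 'cV[R]_n, x != 0 -> 0 < (x^T *m K *m x) 0 0.

(* Same shape as convex_function, with the inequality reversed. *)
Definition concave_function (R : realType) (E : lmodType R)
    (E' := convex_lmodType E) (D : set E') (f : E' -> R^o) : Prop :=
  forall t : {i01 R},
    {in D &, forall x y : E', f x <| t |> f y <= f (x <| t |> y)}.

Definition star_matrix (R : realType) (m : nat) (a b : R) : 'M[R]_m.+1 :=
  \matrix_(i, j) if i == j then 1
                 else if (i == ord0) || (j == ord0) then a else b.

(* Main.v *)
Require Import Defs.
From mathcomp Require Import all_boot all_order all_algebra.
From mathcomp Require Import all_classical all_reals all_analysis.
From mathcomp Require Import ring lra.

Import Order.TTheory GRing.Theory Num.Theory.
Local Open Scope ring_scope.

(** Index 0 is called the centre, the other indices the leaves. Completing the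
    square in the centre coordinate x0 of x, with S the sum of the leaf
    coordinates, gives
      x^T K x = (x0 + a S)^2 + (b - a^2) S^2 + (1 - b) * (sum of the leaf x_i^2),
    which is positive definite as soon as a^2 <= b < 1
    ([star_matrix_posdef]). The same inequality a^2 <= b is the only
    nontrivial instance of the multiplicative triangle inequality: the path
    from a leaf to another leaf through the centre ([star_matrix_triangle]).

    For the failure of concavity, K p is computed along the segment from the
    centre towards the uniform distribution on the leaves: with mass s spread
    uniformly on the leaves,
      H_K(p) = - (1 - s) ln A(s) - s ln B(s),
      A(s) = 1 - (4/5) s,   B(s) = 1/5 - (42/425) s
    ([K_entropy_star_spread]). Its second derivative at s = 0 is
      2 A' + A'^2 - 2 B'/B = -1.6 + 0.64 + 0.988... > 0,
    so H_K is strictly convex on this segment near the centre. The violation of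
    midpoint concavity is certified at s = 1/100, 2/100, 3/100
    ([star_midpoint_gap]). *)

Section StarMatrix.
Variables (R : realType) (m : nat) (a b : R).

Lemma star_matrix_sym : star_matrix m a b \is symmetricmx.
Proof.
rewrite is_hermitianmxE expr0 scale1r.
by apply/eqP/matrixP => i j; rewrite !mxE eq_sym orbC.
Qed.

Lemma mul_star_matrix0 (x : 'cV[R]_m.+1) :
  (star_matrix m a b *m x) ord0 0 =
  x ord0 0 + a * \sum_(i < m) x (lift ord0 i) 0.
Proof.
rewrite mxE big_ord_recl mxE eqxx mul1r mulr_sumr.
by congr (_ + _); apply: eq_bigr => i _; rewrite mxE.
Qed.

Lemma mul_star_matrix_lift (x : 'cV[R]_m.+1) (i : 'I_m) :
  (star_matrix m a b *m x) (lift ord0 i) 0 =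
  a * x ord0 0 + (1 - b) * x (lift ord0 i) 0
  + b * \sum_(j < m) x (lift ord0 j) 0.
Proof.
rewrite mxE big_ord_recl mxE /= -addrA; congr (_ + _).
rewrite (bigD1 i) //= (bigD1 i (P := predT)) //= mulrDr addrA -mulrDl subrK.
congr (_ + _); first by rewrite mxE eqxx.
rewrite mulr_sumr; apply: eq_bigr => j ji.
by rewrite mxE (inj_eq lift_inj) eq_sym (negbTE ji).
Qed.

Lemma star_matrix_quadratic (x : 'cV[R]_m.+1)
    (S := \sum_(i < m) x (lift ord0 i) 0) :
  (x^T *m star_matrix m a b *m x) 0 0 =
  (x ord0 0 + a * S) ^+ 2 + (b - a ^+ 2) * S ^+ 2
  + (1 - b) * \sum_(i < m) x (lift ord0 i) 0 ^+ 2.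
Proof.
rewrite -mulmxA mxE big_ord_recl mxE mul_star_matrix0 -/S.
have -> : \sum_(i < m) x^T 0 (lift ord0 i)
            * (star_matrix m a b *m x) (lift ord0 i) 0 =
          (a * x ord0 0 + b * S) * S
          + (1 - b) * \sum_(i < m) x (lift ord0 i) 0 ^+ 2.
  pose t := a * x ord0 0 + b * S.
  rewrite -/t {1}/S !mulr_sumr -big_split; apply: eq_bigr => i _ /=.
  by rewrite mul_star_matrix_lift mxE -/S /t; ring.
by ring.
Qed.

Lemma star_matrix_posdef : a ^+ 2 <= b -> b < 1 -> posdefmx (star_matrix m a b).
Proof.
move=> ab b1; split; first exact: star_matrix_sym.
move=> x x0; rewrite star_matrix_quadratic.
set S := \sum_(i < m) _; set Q := \sum_(i < m) _.
have Q0 : 0 <= Q by apply: sumr_ge0 => i _; exact: sqr_ge0.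
have c0 : 0 <= (b - a ^+ 2) * S ^+ 2.
  by rewrite mulr_ge0 ?subr_ge0 ?sqr_ge0.
have [Qpos|] := ltP 0 Q.
  by rewrite ltr_wpDl ?addr_ge0 ?sqr_ge0 // mulr_gt0 ?subr_gt0.
move=> Qle0; have /eqP : Q = 0 by apply/eqP; rewrite eq_le Qle0 Q0.
rewrite psumr_eq0 => [/allP xl|i _]; last exact: sqr_ge0.
(* All leaf coordinates vanish, so the centre coordinate does not. *)
have {}xl (i : 'I_m) : x (lift ord0 i) 0 = 0.
  by apply/eqP; move: (xl i); rewrite mem_index_enum sqrf_eq0; apply.
have S0 : S = 0 by apply: big1 => i _.
have xc : x ord0 0 != 0.
  apply: contra_neq x0 => xc; apply/matrixP => i j; rewrite ord1 mxE.
  by case: (unliftP ord0 i) => [k|] ->.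
apply: ltr_wpDr; first by rewrite mulr_ge0 ?subr_ge0 // ltW.
by rewrite S0 mulr0 addr0 expr0n mulr0 addr0 exprn_even_gt0.
Qed.

Lemma star_matrix_triangle : 0 <= a <= 1 -> a ^+ 2 <= b -> b <= 1 ->
  forall i j k : 'I_m.+1,
    star_matrix m a b i j * star_matrix m a b j k <= star_matrix m a b i k.
Proof.
move=> /andP[a0 a1] ab b1 i j k; rewrite !mxE.
have b0 : 0 <= b by exact: le_trans (sqr_ge0 a) ab.
have [->|ij] := eqVneq i j; first by rewrite mul1r.
have [<-|jk] := eqVneq j k; first by rewrite mulr1 (negbTE ij).
have [_|ik] := eqVneq i k.
  by apply: mulr_ile1; case: ifP.
case: (eqVneq j ord0) => [j0|j0] in ij jk *.
  by rewrite -j0 (negbTE ij) eq_sym (negbTE jk) /= -expr2.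
rewrite !orbF; case: (i == ord0); case: (k == ord0) => /=; nra.
Qed.

Definition spread (s : R) : 'cV[R]_m.+1 :=
  \col_i if i == ord0 then 1 - s else s / m%:R.

Lemma sum_spread_leaves s : (0 < m)%N ->
  \sum_(i < m) spread s (lift ord0 i) 0 = s.
Proof.
move=> m0; rewrite (eq_bigr (fun=> s / m%:R)) => [|i _]; last by rewrite mxE.
by rewrite sumr_const card_ord -[LHS]mulr_natr divfK // pnatr_eq0 -lt0n.
Qed.

Lemma spread_open_simplex s : (0 < m)%N -> 0 < s < 1 ->
  spread s \in open_simplex R m.+1.
Proof.
move=> m0 /andP[s0 s1]; rewrite inE; split=> [i|].
  by rewrite mxE; case: ifP => _; rewrite ?subr_gt0 ?divr_gt0 ?ltr0n.
by rewrite big_ord_recl sum_spread_leaves // mxE eqxx subrK.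
Qed.

Lemma spread_midpoint s t :
  2^-1 *: spread s + 2^-1 *: spread t = spread ((s + t) / 2).
Proof. by apply/matrixP => i j; rewrite !mxE; case: ifP => _; lra. Qed.

Lemma K_entropy_star_spread s : (0 < m)%N ->
  K_entropy (star_matrix m a b) (spread s) =
  - ((1 - s) * ln (1 - s + a * s)
     + s * ln (a * (1 - s) + (1 - b) * (s / m%:R) + b * s)).
Proof.
move=> m0; rewrite /K_entropy big_ord_recl mul_star_matrix0.
rewrite sum_spread_leaves // mxE eqxx; congr (- (_ + _)).
rewrite -[in RHS](sum_spread_leaves s m0) mulr_suml; apply: eq_bigr => i _.
by rewrite mul_star_matrix_lift sum_spread_leaves // !mxE.
Qed.

End StarMatrix.

Lemma concave_midpoint (R : realType) (n : nat) (D : set 'cV[R]_n)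
    (f : 'cV[R]_n -> R) (x y : 'cV[R]_n) :
  concave_function D f -> x \in D -> y \in D ->
  (f x + f y) / 2 <= f (2^-1 *: x + 2^-1 *: y).
Proof.
move=> fD xD yD.
have h0 : 0 <= 2^-1 :> R by lra.
have h1 : 2^-1 <= 1 :> R by lra.
have : 2^-1 * f x + (1 - 2^-1) * f y <= f (2^-1 *: x + (1 - 2^-1) *: y).
  exact: (fD (Itv01 h0 h1) x y xD yD).
have -> : (1 - 2^-1) = 2^-1 :> R by lra.
by rewrite -mulrDr mulrC.
Qed.

Lemma ln_sub_le (R : realType) (u v : R) : 0 < u -> 0 < v ->
  ln u - ln v <= u / v - 1.
Proof.
move=> u0 v0; rewrite -ln_div ?posrE // -[X in ln X](subrK 1) [X in ln X]addrC.
by apply: le_ln1Dx; rewrite ltrBrDr addNr divr_gt0.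
Qed.

(** The values of A, and those of B, at s = 1/100, 2/100, 3/100 form arithmetic
    progressions A1, A2, A3 and B1, B2, B3. The gap is of order h^2, where
    h = 1/100, and it is bounded below with an error of order h^3. The
    first-order bound [ln_sub_le] suffices for this once the terms are grouped
    as
      (1 - s) (2 ln A2 - ln A1 - ln A3) - h (ln A1 - ln A3)
      + s (2 ln B2 - ln B1 - ln B3) + h (ln B1 - ln B3),  s = 2/100,
    since in the second differences it is applied to A1 A3 / A2^2, which is
    1 - O(h^2), and the first differences carry a factor h. *)
Lemma star_midpoint_gap (R : realType)
    (A := fun s : R => 1 - 4 / 5 * s) (B := fun s : R => 1 / 5 - 42 / 425 * s) :
  99 / 100 * ln (A (1 / 100)) + 1 / 100 * ln (B (1 / 100))
  + (97 / 100 * ln (A (3 / 100)) + 3 / 100 * ln (B (3 / 100)))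
  < 2 * (98 / 100 * ln (A (2 / 100)) + 2 / 100 * ln (B (2 / 100))).
Proof.
have second_difference (u v w q : R) : 0 < u -> 0 < v -> 0 < w ->
    u * w = q * (v * v) -> ln u + ln w - (ln v + ln v) <= q - 1.
  move=> u0 v0 w0 uwq; rewrite -!lnM ?posrE //.
  apply: le_trans (ln_sub_le _ _ _ _ _) _; rewrite ?mulr_gt0 //.
  by rewrite uwq mulfK ?mulf_neq0 ?gt_eqF.
have first_difference (u v q : R) : 0 < u -> 0 < v ->
    u = q * v -> ln u - ln v <= q - 1.
  move=> u0 v0 uq; apply: le_trans (ln_sub_le _ _ _ u0 v0) _.
  by rewrite {1}uq mulfK ?gt_eqF.
have A1 : 0 < A (1 / 100) by rewrite /A; lra.
have A2 : 0 < A (2 / 100) by rewrite /A; lra.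
have A3 : 0 < A (3 / 100) by rewrite /A; lra.
have B1 : 0 < B (1 / 100) by rewrite /B; lra.
have B2 : 0 < B (2 / 100) by rewrite /B; lra.
have B3 : 0 < B (3 / 100) by rewrite /B; lra.
(* A1 : A2 : A3 = 124 : 123 : 122 and B1 : B2 : B3 = 4229 : 4208 : 4187. *)
have ddA := second_difference _ _ _ (1 - (1 / 123) ^+ 2) A1 A2 A3.
have ddB := second_difference _ _ _ (1 - (21 / 4208) ^+ 2) B1 B2 B3.
have dA := first_difference _ _ (124 / 122) A1 A3.
have dB := first_difference _ _ (4187 / 4229) B3 B1.
have {}ddA := ddA ltac:(rewrite /A; field).
have {}ddB := ddB ltac:(rewrite /B; field).
have {}dA := dA ltac:(rewrite /A; field).
have {}dB := dB ltac:(rewrite /B; field).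
move: ddA ddB dA dB.
generalize (ln (A (1 / 100))) (ln (A (2 / 100))) (ln (A (3 / 100))).
generalize (ln (B (1 / 100))) (ln (B (2 / 100))) (ln (B (3 / 100))).
by rewrite /A /B => *; lra.
Qed.

Theorem mainTheorem8 (R : realType) :
  let m := 17%N in
  let a : R := 2%:R / 10%:R in
  let b : R := 45%:R / 1000%:R in
  let K : 'M[R]_m.+1 := star_matrix m a b in
  [/\ posdefmx K,
      forall i j k : 'I_m.+1, K i j * K j k <= K i k
    & ~ concave_function (open_simplex R m.+1) (K_entropy K)].
Proof.
move=> m a b K; split.
- by apply: star_matrix_posdef; rewrite /a /b; lra.
- by apply: star_matrix_triangle; rewrite /a /b; lra.
move=> Kconcave.
have i1 : 0 < (1 / 100 : R) < 1 by lra.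
have i3 : 0 < (3 / 100 : R) < 1 by lra.
have := concave_midpoint _ _ _ _ _ _ Kconcave
  (spread_open_simplex _ m _ isT i1) (spread_open_simplex _ m _ isT i3).
rewrite spread_midpoint !K_entropy_star_spread //.
have midE : (1 / 100 + 3 / 100) / 2 = 2 / 100 :> R by lra.
have AE (s : R) : 1 - s + a * s = 1 - 4 / 5 * s by rewrite /a; lra.
have BE (s : R) :
    a * (1 - s) + (1 - b) * (s / m%:R) + b * s = 1 / 5 - 42 / 425 * s.
  by rewrite /a /b /m; field.
rewrite midE !AE !BE; apply/negP; rewrite -ltNge.
have := star_midpoint_gap R; cbv zeta beta.
by lra.
Qed.
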